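(* Let $G$ be a torsion abelian group. If $r_p(G)$ is finite for every prime $p$, then $ns(G)=0$.
   Context: $\mathbb N=\{0,1,2,\dots\}$ and $\mathbb N_+=\mathbb N\setminus\{0\}$. Let $\phi$ be an endomorphism of an abelian group $G$. A string of $\phi$ is a sequence $S=\{x_n\}_{n\in\mathbb N}$ of pairwise distinct elements of $G$ such that $\phi(x_n)=x_{n-1}$ for every $n\in\mathbb N_+$. A string is singular if $\phi^j(x_0)=\phi^k(x_0)$ for some $j\neq k$ in $\mathbb N$, and non-singular otherwise. Define $ns(\phi)$ as the supremum of the cardinalities $|\mathcal F|$, where $\mathcal F$ ranges over the families of pairwise disjoint non-singular strings of $\phi$; if this supremum is infinite it is set equal to the symbol $\infty$. For an abelian group $G$, $ns(G)=\sup\{ns(\phi):\phi\in\mathrm{End}(G)\}$. For a prime $p$, $r_p(G)=\dim_{\mathbb F_p}G[p]$ is the $p$-rank of $G$, where $G[p]=\{x\in G: px=0\}$. *)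

(* Defs.v *)
From HB Require Import structures.
From mathcomp Require Import all_boot all_order all_algebra.
From mathcomp Require Import boolp classical_sets functions cardinality.
From mathcomp Require Import reals ereal measure Rstruct.

Set Implicit Arguments.
Unset Strict Implicit.
Unset Printing Implicit Defensive.

Import Order.TTheory GRing.Theory Num.Theory.

Local Open Scope classical_set_scope.
Local Open Scope ring_scope.

(* Cardinalities are values in \bar R, all infinite ones being identified
   with +oo. *)
Notation ecard A := (counting (R := Rdefinitions.R) A).

Section Strings.
Variable G : zmodType.
Implicit Types (phi : {additive G -> G}) (S : nat -> G).

Definition is_string phi S :=
  injective S /\ forall n : nat, (0 < n)%N -> phi (S n) = S n.-1.

Definition singular phi S :=
  exists j k : nat, j <> k /\ iter j phi (S 0%N) = iter k phi (S 0%N).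

Definition nonsingular_string phi S := is_string phi S /\ ~ singular phi S.

(* A string is nonempty, so a pairwise disjoint family has no repetitions
   and may be identified with its set of members. *)
Definition disjoint_nonsingular_family phi (F : set (nat -> G)) :=
  (forall S, F S -> nonsingular_string phi S) /\
  trivIset F (fun S => range S).

Definition ns_endo phi : \bar Rdefinitions.R :=
  ereal_sup [set ecard F | F in [set F | disjoint_nonsingular_family phi F]].

End Strings.

Definition ns_group (G : zmodType) : \bar Rdefinitions.R :=
  ereal_sup (range (fun phi : {additive G -> G} => ns_endo phi)).

Definition torsion_group (G : zmodType) :=
  forall x : G, exists2 n : nat, (0 < n)%N & x *+ n = 0.

Section Dimension.
Variables (K : fieldType) (V : lmodType K).
Implicit Type B : set V.

Definition lin_indep B :=
  forall (s : seq V) (c : V -> K), uniq s -> (forall x, x \in s -> B x) ->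
    \sum_(x <- s) c x *: x = 0 -> forall x, x \in s -> c x = 0.

Definition spanning B :=
  forall v : V, exists (s : seq V) (c : V -> K),
    (forall x, x \in s -> B x) /\ v = \sum_(x <- s) c x *: x.

Definition is_basis B := lin_indep B /\ spanning B.

(* The cardinality of any basis; since bases exist, the default +oo of xget
   is not used. *)
Definition dimension : \bar Rdefinitions.R :=
  xget +oo%E [set ecard B | B in is_basis].

End Dimension.

Section PTorsion.
Variables (G : zmodType) (p : nat).

Definition ptors_pred : {pred G} := [pred x : G | x *+ p == 0].

Lemma ptors_zmod_closed : zmod_closed ptors_pred.
Proof.
split=> [|x y]; rewrite !inE ?mul0rn// => /eqP x0 /eqP y0.
by rewrite mulrnBl x0 y0 subr0.
Qed.

HB.instance Definition _ :=
  GRing.isZmodClosed.Build G ptors_pred ptors_zmod_closed.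

(* The proof of primality is a parameter because the 'F_p-module structure
   exists only for p prime. *)
Record ptors (p_pr : prime p) : Type :=
  PTors { ptors_val : G; _ : ptors_val \in ptors_pred }.

Hypothesis p_pr : prime p.
Local Notation Gp := (ptors p_pr).

HB.instance Definition _ := [isSub for @ptors_val p_pr].
HB.instance Definition _ := [Choice of Gp by <:].
HB.instance Definition _ := [SubChoice_isSubZmodule of Gp by <:].

Definition ptors_scale (a : 'F_p) (x : Gp) : Gp := x *+ (a : nat).

Lemma ptors_mulrn (x : Gp) : x *+ p = 0.
Proof. by apply: val_inj; rewrite raddfMn /=; apply/eqP; exact: (valP x). Qed.

Lemma ptors_mulrn_mod (x : Gp) (n : nat) :
  x *+ (n %% (Zp_trunc (pdiv p)).+2) = x *+ n.
Proof.
rewrite Fp_cast// [in RHS](divn_eq n p) mulrnDr mulnC mulrnA ptors_mulrn.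
by rewrite mul0rn add0r.
Qed.

Lemma ptors_scaleA a b x : ptors_scale a (ptors_scale b x) = ptors_scale (a * b) x.
Proof. by rewrite /ptors_scale -mulrnA /= ptors_mulrn_mod mulnC. Qed.

Lemma ptors_scale1 : left_id 1 ptors_scale.
Proof. by move=> x; rewrite /ptors_scale /= ?ptors_mulrn_mod. Qed.

Lemma ptors_scaleDr : right_distributive ptors_scale +%R.
Proof. by move=> a x y; rewrite /ptors_scale mulrnDl. Qed.

Lemma ptors_scaleDl x : {morph ptors_scale^~ x : a b / a + b}.
Proof. by move=> a b; rewrite /ptors_scale /= ptors_mulrn_mod mulrnDr. Qed.

HB.instance Definition _ := GRing.Zmodule_isLmodule.Build 'F_p Gp
  ptors_scaleA ptors_scale1 ptors_scaleDr ptors_scaleDl.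

Definition p_rank : \bar Rdefinitions.R := @dimension 'F_p Gp.

End PTorsion.

Arguments p_rank G {p} p_pr.

(* Main.v *)
Require Import Defs.
From mathcomp Require Import all_boot all_order all_algebra.
From mathcomp Require Import boolp classical_sets functions cardinality.
From mathcomp Require Import reals ereal measure Rstruct.

(** The order [m] of [x : G] confines the whole orbit of [x] under an
    endomorphism [phi] to the fully invariant subgroup [G[m]].  When every
    [G[p]] with [p] prime is finite, every [G[m]] with [m > 0] is finite too,
    because multiplication by [a] maps [G[a * b]] into [G[b]] with kernel
    [G[a]]; this is [finite_mulrn_torsion].  Hence the orbit of the first term
    of a string takes some value twice, so that every string is singular, the
    only family of non-singular strings is the empty one, and [ns(G) = 0].

    The finiteness of [G[p]] is read off its finite dimension: a basis with
    finitely many elements has only finitely many linear combinations over a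
    finite field ([finite_dimension_finite]). *)

Import GRing.Theory.

Local Open Scope classical_set_scope.
Local Open Scope ring_scope.

Lemma finite_span (K : finFieldType) (V : lmodType K) (B : set V) :
  finite_set B -> spanning B -> finite_set [set: V].
Proof.
move=> /finite_seqP[t ->] tV.
pose comb (f : {ffun 'I_(size t) -> K}) : V :=
  \sum_(i < size t) f i *: tnth (in_tuple t) i.
suff sub : [set: V] `<=` range comb.
  by apply: sub_finite_set sub _; apply: finite_image; exact: finite_finset.
move=> v _; have [s [c [sB ->]]] := tV v.
(* [s] may repeat elements of [t], so coefficients are added up one by one. *)
elim: s sB => [|x s IHs] sB.
  exists 0 => //; rewrite /comb big_nil big1// => i _.
  by rewrite ffunE scale0r.
have [f _ fE] : range comb (\sum_(y <- s) c y *: y).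
  by apply: IHs => y ys; apply: sB; rewrite in_cons ys orbT.
have /(tnthP (in_tuple t))[i xE] : x \in t by apply: sB; rewrite mem_head.
exists ([ffun j => if j == i then c x else 0] + f) => //.
rewrite big_cons -fE /comb.
under eq_bigr do rewrite !ffunE scalerDl.
rewrite big_split/= (bigD1 i)//= eqxx -xE big1 ?addr0// => j /negbTE ->.
by rewrite scale0r.
Qed.

(** The default value [+oo] of [dimension] is not finite, so a finite
    dimension is the cardinality of an actual basis. *)
Lemma finite_dimension_finite (K : finFieldType) (V : lmodType K) :
  dimension V \is a fin_num -> finite_set [set: V].
Proof.
rewrite /dimension; case: xgetP => // _ _ [B [_ spanB] <-].
rewrite /counting; case: asboolP => // finB _.
exact: finite_span finB spanB.
Qed.

Lemma finite_p_torsion (G : zmodType) (p : nat) (p_pr : prime p) :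
  p_rank G p_pr \is a fin_num -> finite_set [set x : G | x *+ p = 0].
Proof.
move=> /finite_dimension_finite/(finite_image (@ptors_val G p p_pr)).
apply: sub_finite_set => x /eqP xp.
by exists (PTors p_pr xp).
Qed.

(** With [h] a choice of preimages under multiplication by [a], every [x] in
    [G[a * b]] is the sum of [h (x *+ a)], which depends only on an element
    of [G[b]], and of an element of [G[a]]. *)
Lemma finite_mulrn_torsion (G : zmodType) (a b : nat) :
  finite_set [set x : G | x *+ a = 0] -> finite_set [set x : G | x *+ b = 0] ->
  finite_set [set x : G | x *+ (a * b) = 0].
Proof.
move=> finA finB.
pose h (y : G) := xget 0 [set z | z *+ a = y].
apply: sub_finite_set (finite_image2 (fun u y => u + h y) finA finB).
move=> x /= xab; have ha : h (x *+ a) *+ a = x *+ a.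
  exact: (@xgetPex _ 0 [set z | z *+ a = x *+ a] (ex_intro _ x erefl)).
exists (x - h (x *+ a)); first by rewrite /= mulrnBl ha subrr.
by exists (x *+ a); rewrite /= -?mulrnA ?subrK.
Qed.

Lemma finite_torsion (G : zmodType) :
  (forall p, prime p -> finite_set [set x : G | x *+ p = 0]) ->
  forall m : nat, (0 < m)%N -> finite_set [set x : G | x *+ m = 0].
Proof.
move=> fin_prime; elim/ltn_ind => m IHm m_gt0.
have [m_le1|m_gt1] := leqP m 1.
  apply: sub_finite_set (finite_set1 (0 : G)) => x /=.
  by have -> : m = 1%N by apply/eqP; rewrite eqn_leq m_le1.
have p_pr := pdiv_prime m_gt1.
rewrite -(divnK (pdiv_dvd m)); apply: finite_mulrn_torsion (fin_prime _ p_pr).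
apply: IHm; first by rewrite ltn_Pdiv// prime_gt1.
by rewrite divn_gt0 ?pdiv_gt0// dvdn_leq// pdiv_dvd.
Qed.

Lemma singular_of_finite_torsion (G : zmodType) (phi : {additive G -> G})
    (S : nat -> G) (m : nat) :
  S 0%N *+ m = 0 -> finite_set [set x : G | x *+ m = 0] -> singular phi S.
Proof.
move=> S0m finm; apply: contrapT => nsing; apply: infinite_nat.
have orbit_inj : injective (fun n => iter n phi (S 0%N)).
  by move=> j k jk; apply: contrapT => ?; apply: nsing; exists j, k.
have /sub_finite_set : [set: nat] `<=`
    (fun n => iter n phi (S 0%N)) @^-1` [set x : G | x *+ m = 0].
  by move=> n _ /=; elim: n => //= n IHn; rewrite -raddfMn IHn raddf0.
by apply; apply: finite_preimage finm => j k _ _; exact: orbit_inj.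
Qed.

Lemma ns_group_eq0 (G : zmodType) :
  (forall (phi : {additive G -> G}) S, is_string phi S -> singular phi S) ->
  ns_group G = 0%E.
Proof.
move=> sing; have ns0 (phi : {additive G -> G}) : ns_endo phi = 0%E.
  rewrite /ns_endo.
  have -> : [set F | disjoint_nonsingular_family phi F] = [set set0].
    apply/seteqP; split=> F /=; last first.
      by move=> ->; split=> // S S' [].
    move=> [nonsing _]; rewrite -subset0 => S /nonsing[strS].
    by apply; exact: sing.
  by rewrite image_set1 /counting asboolT ?fset_set0 ?ereal_sup1.
rewrite /ns_group (_ : range _ = [set 0%E]) ?ereal_sup1//.
apply/seteqP; split=> [_ [phi _ <-]|_ ->]; first exact: ns0.
by exists (idfun : {additive G -> G}).
Qed.

Theorem corollary3p5 (G : zmodType) (G_torsion : torsion_group G)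
  (rank_fin : forall (p : nat) (p_pr : prime p), p_rank G p_pr \is a fin_num) :
  ns_group G = 0%E.
Proof.
apply: ns_group_eq0 => phi S _.
have [m m_gt0 S0m] := G_torsion (S 0%N).
apply: singular_of_finite_torsion S0m _; apply: finite_torsion m_gt0 => p p_pr.
exact: finite_p_torsion (rank_fin p p_pr).
Qed.
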